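(* Let $\alpha\in(0,1)$. For every $\epsilon>0$ there exist $N$ and $\delta\in(0,1/2]$ such that for every even $n>N$, if $(X_1,Y_1),\ldots,(X_{n+1},Y_{n+1})$ are drawn i.i.d. from the distribution $P^\delta$ and the split procedure (described in the context) is run on $(X_1,Y_1),\ldots,(X_n,Y_n)$ and $X_{n+1}$ with $\hat\mu\equiv 0$ and $n_1=n_2=n/2$ to obtain $\hat C_n(X_{n+1})$, then $$\mathbb{P}\{\mathrm{Median}(Y_{n+1}\mid X_{n+1})\in\hat C_n(X_{n+1})\}\le 1-\alpha+\epsilon .$$
   Context: $P^\delta$ is the distribution of $(X,Y)\in\mathbb{R}\times\mathbb{R}$ where $X\sim\mathrm{Unif}[-0.5,0.5]$ and $Y=XB$ with $B\in\{0,1\}$ a Bernoulli variable independent of $X$, $\mathbb{P}(B=1)=0.5+\delta$. Under $P^\delta$ the conditional median is $\mathrm{Median}(Y\mid X=x)=x$, and $\mathrm{Median}(Y_{n+1}\mid X_{n+1})$ is this function evaluated at $X_{n+1}$. Split procedure. Randomly split $\{1,\ldots,n\}$, independently of the data, into disjoint $\mathcal I_1,\mathcal I_2$ with $|\mathcal I_1|=n_1$, $|\mathcal I_2|=n_2$. Fit a regression function $\hat\mu$ on $\{(X_i,Y_i):i\in\mathcal I_1\}$ (here $\hat\mu(x)=0$ for all $x$, regardless of the data). For $i\in\mathcal I_2$ set $E_i=|Y_i-\hat\mu(X_i)|$. Let $Q_{1-\alpha/2}(E)$ be the $(1-\alpha/2)(1+1/n_2)$-th empirical quantile of $\{E_i:i\in\mathcal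 I_2\}$, i.e. the $\lceil(1-\alpha/2)(n_2+1)\rceil$-th smallest value (equal to $+\infty$ if this index exceeds $n_2$). Output $$\hat C_n(X_{n+1})=[\hat\mu(X_{n+1})-Q_{1-\alpha/2}(E),\ \hat\mu(X_{n+1})+Q_{1-\alpha/2}(E)].$$ *)

(* Defs.v *)
From HB Require Import structures.
From mathcomp Require Import all_boot all_order all_algebra.
From mathcomp Require Import all_classical all_reals all_analysis.

Set Implicit Arguments.
Unset Strict Implicit.
Unset Printing Implicit Defensive.

Import Order.TTheory GRing.Theory Num.Theory.
Import numFieldNormedType.Exports.

Local Open Scope classical_set_scope.
Local Open Scope ring_scope.

Lemma half_interval (R : realType) : - 2^-1 < 2^-1 :> R.
Proof. by rewrite gtrN// invr_gt0. Qed.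

(* Law of (X, X * B) for independent X ~ Unif[-1/2, 1/2] and
   B ~ Bernoulli(1/2 + delta).  [bernoulli_prob p] is a Bernoulli law only for
   0 <= p <= 1, that is for -1/2 <= delta <= 1/2. *)
Definition Pdelta (R : realType) (delta : R) : set (R * R) -> \bar R :=
  pushforward
    (uniform_prob (half_interval R) \x bernoulli_prob (2^-1 + delta))%E
    (fun xb : R * bool => (xb.1, xb.1 * xb.2%:R)).

Section independence.
Context d d' (T : measurableType d) (U : measurableType d') (R : realType).
Variable P : probability T R.

Definition mutually_independent (I : finType) (Z : I -> T -> U) : Prop :=
  forall (J : {set I}) (A : I -> set U), (forall i, measurable (A i)) ->
    P [set w | forall i, i \in J -> A i (Z i w)] =
    (\prod_(i in J) P (Z i @^-1` A i))%E.

Definition iid (I : finType) (Z : I -> T -> U) (law : set U -> \bar R) : Prop :=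
  [/\ forall i, measurable_fun setT (Z i),
      mutually_independent Z &
      forall i A, measurable A -> pushforward P (Z i) A = law A].

(* [S] takes finitely many values, so the events [S = s] generate its
   sigma-algebra; [g_sigma_preimage Z] is the one generated by the family [Z]. *)
Definition independent_of_family (F : finType) n
    (S : T -> F) (Z : 'I_n -> T -> U) : Prop :=
  forall (s : F) (E : set T), g_sigma_preimage Z E ->
    P (S @^-1` [set s] `&` E) = (P (S @^-1` [set s]) * P E)%E.

End independence.

(* The pair (I_1, I_2) of index sets is random; its law is not prescribed beyond
   the sizes and the independence from all the observations, test point
   included. *)
Definition random_split d d' (T : measurableType d) (U : measurableType d')
    (R : realType) (P : probability T R) n (Z : 'I_n.+1 -> T -> U) (n1 n2 : nat)
    (S : T -> {set 'I_n} * {set 'I_n}) : Prop :=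
  [/\ forall s, measurable (S @^-1` [set s]),
      forall w, [/\ [disjoint (S w).1 & (S w).2]%B,
                    ((S w).1 :|: (S w).2)%SET = [set: 'I_n]%SET,
                    #|(S w).1| = n1 & #|(S w).2| = n2] &
      independent_of_family P S Z].

Section split_procedure.
Variable R : realType.

(* The ceil(beta * (size s + 1))-th smallest entry of [s], +oo when that rank
   exceeds [size s].  Entries of [sort] are numbered from 0; the rank is
   positive when 0 < beta. *)
Definition conformal_quantile (beta : R) (s : seq R) : \bar R :=
  let k := `|Num.ceil (beta * (size s).+1%:R)|%N in
  if (k <= size s)%N then (nth 0 (sort <=%R s) k.-1)%:E else +oo%E.

(* A regression algorithm maps a training sample to a regression function. *)
Definition split_interval (fit : seq (R * R) -> R -> R) (alpha : R) n
    (D : 'I_n -> R * R) (S : {set 'I_n} * {set 'I_n}) (x : R) : set R :=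
  let mu := fit [seq D i | i <- enum S.1] in
  let E := [seq `|(D i).2 - mu (D i).1| | i <- enum S.2] in
  let Q := conformal_quantile (1 - alpha / 2) E in
  [set y | ((mu x)%:E - Q <= y%:E <= (mu x)%:E + Q)%E].

Definition zero_fit : seq (R * R) -> R -> R := fun _ _ => 0.

End split_procedure.

Section conditional_median.
Context d (T : measurableType d) (R : realType).
Variable P : probability T R.

Definition is_median (mu : set R -> \bar R) (m : R) : Prop :=
  ((2^-1)%:E <= mu `]-oo, m]%classic /\ (2^-1)%:E <= mu `[m, +oo[%classic)%E.

(* [kappa] is a regular conditional distribution of [Y] given [X]. *)
Definition is_conditional_law (X Y : T -> R) (kappa : R.-pker R ~> R) : Prop :=
  forall A B : set R, measurable A -> measurable B ->
    P (X @^-1` A `&` Y @^-1` B) = (\int[P]_(w in X @^-1` A) kappa (X w) B)%E.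

(* [m (X w)] is a version of Median(Y | X). *)
Definition is_conditional_median (X Y : T -> R) (m : R -> R) : Prop :=
  measurable_fun setT m /\
  exists2 kappa : R.-pker R ~> R, is_conditional_law X Y kappa &
    {ae P, forall w, is_median (kappa (X w)) (m (X w))}.

End conditional_median.

(* Main.v *)
Require Import Defs.
From HB Require Import structures.
From mathcomp Require Import all_boot all_order all_algebra.
From mathcomp Require Import all_classical all_reals all_analysis.
From mathcomp Require Import measurable_realfun ring lra.

(** Write X and Y for the covariate and response of the test point, E_i = |Y_i|
    for the calibration scores, and Q for their conformal quantile; since the
    fitted function is zero, the interval is [-Q, Q].

    Under the law of (X, XB) with P(B = 1) = 1/2 + delta, the conditional median
    at x is x itself as soon as delta > 0, so coverage of the median is the
    event |X| <= Q.  The scores are |X_i| B_i, and nearly half of them vanish: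
    P(E_i <= t) = 1 - (1/2 + delta)(1 - 2t) for 0 <= t <= 1/2.  The
    (1 - alpha/2)-quantile of this law tends, as delta goes to 0, to the value t
    with 2t = 1 - alpha, and P(|X| <= t) = 2t.  Hence the excess level
    1 - alpha/2 on the scores is only the level 1 - alpha on |X|.

    To make this quantitative let h = min(alpha, eps), delta = h/8 and
    2t = 1 - alpha + h/2.  If the median is covered then |m(X)| <= t or Q > t.
    - A version m of the conditional median satisfies |m(X)| <= t with
      probability at most P(|X| <= t) = 2t ([conditional_median_norm_le]).  Only
      the defining integral identity of a conditional law is needed: on
      {X > t, m(X) <= t} the half-line ending at t has conditional mass at least
      1/2, whereas Y falls in it only when B = 0, which has probability
      1/2 - delta < 1/2; so this event is null
      ([conditional_median_avoids_minority]).
    - Q > t says that fewer than k scores are at most t, where k is the rank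
      defining Q ([conformal_quantile_ge]).  The expected number of such scores
      exceeds k by at least h/16 times the sample size
      ([calibration_rank_below_mean]), and Chebyshev's inequality makes the
      event as unlikely as desired ([count_lt_chebyshev]).  The calibration set
      is random, but it is independent of the data and the bound is the same for
      each of its values, so it survives averaging ([independent_index_le]). *)

Set Implicit Arguments.
Unset Strict Implicit.

Import Order.TTheory GRing.Theory Num.Theory.
Import numFieldNormedType.Exports.

Local Open Scope classical_set_scope.
Local Open Scope ring_scope.

(** * Quantiles and counts *)

(** The quantile is the k-th smallest entry, and it is at least [v] exactly when
    fewer than k entries precede [v].  The infinite value fits the same
    rule: k then exceeds the number of entries, hence every count.  This turns
    events about the quantile into events about counts. *)
Lemma conformal_quantile_ge (R : realType) (beta : R) (s : seq R) (v : R) :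
  0 < beta ->
  (v%:E <= conformal_quantile beta s)%E =
  (count (fun e => (e < v)%R) s < `|Num.ceil (beta * (size s).+1%:R)|)%N.
Proof.
move=> beta0; rewrite /conformal_quantile.
have : (0 < `|Num.ceil (beta * (size s).+1%:R)|)%N.
  by rewrite absz_gt0 gt_eqF// -(ltr_int R) (lt_le_trans _ (ceil_ge _))// mulr_gt0.
case: `|_|%N => // k _.
have [sk|ks] := leqP; first by rewrite leey ltnS (leq_trans (count_size _ _)).
rewrite lee_fin /= ltnS -(count_sort <=%R).
have ss : sorted <=%R (sort <=%R s) by apply: sort_sorted; exact: le_total.
apply/idP/idP => [|ck].
  by apply: contraTT; rewrite -ltnNge -ltNge; exact: nth_count_lt.
by apply: nth_count_ge => //; rewrite ck size_sort.
Qed.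

Lemma measurable_count_lt d (T : measurableType d) (I : Type)
    (b : I -> T -> bool) (J : seq I) (k : nat) :
  (forall i, measurable [set w | b i w]) ->
  measurable [set w | (count (b^~ w) J < k)%N].
Proof.
move=> mb; elim: J k => [|i J IH] k /=.
  by have -> : [set w : T | (0 < k)%N] = if (0 < k)%N then setT else set0;
    [case: ifP => _; apply/seteqP; split | case: ifP].
have -> : [set w | (b i w + count (b^~ w) J < k)%N] =
  ([set w | b i w] `&` [set w | (count (b^~ w) J < k.-1)%N]) `|`
  (~` [set w | b i w] `&` [set w | (count (b^~ w) J < k)%N]).
  apply/seteqP; split => w /=; case: (b i w) => /=.
  - by case: k => // k; left.
  - by right.
  - by case=> -[] //; case: k.
  - by case=> -[].
by apply: measurableU; apply: measurableI => //; exact: measurableC.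
Qed.

(** * Chebyshev's inequality for counts *)

Lemma Lfun2_indic d (T : measurableType d) (R : realType)
    (P : probability T R) (A : set T) :
  measurable A -> (\1_A : T -> R) \in Lfun P 2%:E.
Proof.
move=> mA; rewrite inE; apply/andP; split; rewrite inE//=.
rewrite /finite_norm unlock poweR_lty//.
under eq_integral => x _ do
  rewrite /= ger0_norm// -[2]/(2%:R) powR_mulrn// indicE expr2 -natrM mulnb andbb -indicE.
by rewrite integral_indic// setIT (le_lt_trans (probability_le1 _ _))// ltry.
Qed.

Lemma variance_sum_uncorrelated d (T : measurableType d) (R : realType)
    (P : probability T R) (I : eqType) (X : I -> T -> R) (J : seq I) :
  uniq J -> (forall i, X i \in Lfun P 2%:E) ->
  (forall i j, i \in J -> j \in J -> i != j -> covariance P (X i) (X j) = 0%E) ->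
  'V_P[\sum_(i <- J) X i] = (\sum_(i <- J) 'V_P[X i])%E.
Proof.
move=> + X2; elim: J => [_ _|i J IH /= /andP[iJ uJ] cov0].
  by rewrite !big_nil variance_cst.
have S2 K : \sum_(j <- K) X j \in Lfun P 2%:E.
  by apply: rpred_sum => [|? _ //]; rewrite lee1n.
rewrite !big_cons varianceD ?S2// IH//; last first.
  by move=> j k jJ kJ; apply: cov0; rewrite inE ?jJ ?kJ orbT.
(* Bilinearity reduces the cross term to pairwise covariances. *)
suff -> : covariance P (X i) (\sum_(j <- J) X j) = 0%E by rewrite mule0 adde0.
have : forall j, j \in J -> covariance P (X i) (X j) = 0%E.
  move=> j jJ; apply: cov0; rewrite ?mem_head// ?inE ?jJ ?orbT//.
  by apply: contraNneq iJ => ->.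
elim: J {iJ uJ cov0 IH} => [|j J IH] c0.
  by rewrite big_nil covariance_cst_r.
rewrite big_cons covarianceDr// c0 ?mem_head// add0e IH// => l lJ.
by apply: c0; rewrite inE lJ orbT.
Qed.

(** Pairwise independence makes the indicators uncorrelated, so the variance of
    their sum is at most the number of summands, each having variance at most 1.  A count below k deviates from its mean by at least [a]. *)
Lemma count_lt_chebyshev d (T : measurableType d) (R : realType)
    (P : probability T R) (I : eqType) (b : I -> T -> bool) (J : seq I)
    (q a : R) (k : nat) :
  uniq J -> 0 < a -> k%:R <= (size J)%:R * q - a ->
  (forall i, measurable [set w | b i w]) ->
  (forall i, i \in J -> P [set w | b i w] = q%:E) ->
  (forall i j, i \in J -> j \in J -> i != j ->
     P ([set w | b i w] `&` [set w | b j w]) = (q * q)%:E) ->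
  (P [set w | (count (b^~ w) J < k)%N]
     <= ((size J)%:R / a ^+ 2)%:E)%E.
Proof.
move=> uJ a0 kqa mb Pb Pbb.
pose X i : T -> R := \1_[set w | b i w].
have X2 i : X i \in Lfun P 2%:E by exact: Lfun2_indic.
have Pfin : P setT \is a fin_num by rewrite fin_num_measure.
have X1 i : X i \in Lfun P 1 by apply: (Lfun_subset12 Pfin).
have EX i : i \in J -> 'E_P[X i]%E = q%:E.
  by move=> iJ; rewrite expectation_indic// Pb.
have SE w : (\sum_(i <- J) X i) w = (count (b^~ w) J)%:R.
  rewrite fct_sumE -sum1_count natr_sum [RHS]big_mkcond /=.
  apply: eq_bigr => i _; rewrite /X indicE.
  by case: ifPn => bw; [rewrite mem_set|rewrite memNset// => /= bw'; rewrite bw' in bw].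
have mS : measurable_fun setT (\sum_(i <- J) X i).
  have : \sum_(i <- J) X i \in Lfun P 2%:E.
    by apply: rpred_sum => [|? _ //]; rewrite lee1n.
  by move/sub_Lfun_mfun; rewrite inE.
have ES : 'E_P[\sum_(i <- J) X i]%E = ((size J)%:R * q)%:E.
  rewrite -(big_map X xpredT id) expectation_sum; last first.
    by move=> Xi /mapP[i _ ->].
  rewrite big_map big_seq (eq_bigr (fun=> q%:E)) => [|i iJ]; last exact: EX.
  rewrite -big_seq sumEFin big_const_seq count_predT iter_addr_0.
  by rewrite mulr_natl.
have VS : ('V_P[(\sum_(i <- J) X i)%R] <= ((size J)%:R)%:E)%E.
  rewrite variance_sum_uncorrelated//; last first.
    move=> i j iJ jJ ij; rewrite covarianceE ?Lfun2_mul_Lfun1//.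
    have -> : (X i * X j)%R = \1_([set w | b i w] `&` [set w | b j w]).
      by rewrite /X indicI.
    by rewrite !EX// expectation_indic ?Pbb ?subee//; exact: measurableI.
  rewrite -sum1_size natr_sum -sumEFin; apply: lee_sum => i _.
  rewrite varianceE//.
  have -> : (X i ^+ 2)%R = X i.
    apply/funext => w; rewrite /X /= fctE /= !indicE.
    by case: (_ \in _); rewrite ?expr1n ?expr0n.
  apply: (@le_trans _ _ 'E_P[X i]%E).
    by rewrite leeBlDr ?leeDl ?sqre_ge0// fin_numX// expectation_fin_num.
  by rewrite expectation_indic// probability_le1.
pose S : {RV P >-> R} := mfun_Sub (mem_set mS).
have := @chebyshev _ _ _ P S a a0.
rewrite /= ES /=.
move=> cheb; rewrite EFinM muleC.
apply: (le_trans _ (lee_wpmul2l _ VS)); last by rewrite lee_fin invr_ge0 sqr_ge0.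
apply: (le_trans _ cheb); apply: le_measure; rewrite ?inE.
- exact: measurable_count_lt.
- have -> : [set w | a <= `|(\sum_(i <- J) X i) w - (size J)%:R * q|] =
    (fun w => `|(\sum_(i <- J) X i) w - (size J)%:R * q|) @^-1` `[a, +oo[.
    by apply/seteqP; split => w; rewrite /= in_itv/= andbT.
  rewrite -[X in measurable X]setTI.
  by apply: measurableT_comp => //; exact: measurable_realfun.measurable_funB.
- move=> w /= /ltnW; rewrite -(ler_nat R) => cw.
  by rewrite SE ler_normr; apply/orP; right; lra.
Qed.

(** * The law of (X, XB) *)

(** Conditioning on B shows the law as the mixture of the uniform law carried by
    the diagonal (B = 1) and the uniform law carried by the horizontal axis
    (B = 0). *)
Lemma PdeltaE (R : realType) (delta : R) (A : set (R * R)) :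
  0 <= delta <= 2^-1 -> measurable A ->
  (Pdelta delta A =
   (2^-1 + delta)%:E * uniform_prob (half_interval R) [set x | A (x, x)] +
   (2^-1 - delta)%:E * uniform_prob (half_interval R) [set x | A (x, 0%R : R)])%E.
Proof.
move=> d01 mA; rewrite /Pdelta /pushforward.
set U := uniform_prob _.
have p01 : 0 <= 2^-1 + delta <= 1 by lra.
have m1 : measurable [set x | A (x, x)].
  rewrite -[X in measurable X]setTI.
  exact: (measurable_fun_pair (@measurable_id _ _ setT)
    (@measurable_id _ _ setT) measurableT).
have m0 : measurable [set x : R | A (x, 0%R : R)].
  rewrite -[X in measurable X]setTI.
  exact: (measurable_fun_pair (@measurable_id _ _ setT)
    (@measurable_cst _ _ _ _ setT (0 : R)) measurableT).
have -> : (fun xb : R * bool => (xb.1, xb.1 * xb.2%:R)) @^-1` A =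
  ([set x | A (x, x)] `*` [set true]) `|` ([set x | A (x, 0%R : R)] `*` [set false]).
  apply/seteqP; split => -[x []] /=; rewrite ?mulr1 ?mulr0.
  - by left.
  - by right.
  - by case=> -[].
  - by case=> -[].
rewrite measureU; last 3 first.
- exact: measurableX.
- exact: measurableX.
- by apply/seteqP; split => -[x b] // [[_ /= ->]] [].
rewrite [X in (X + _)%E = _]product_measure1E// [X in (_ + X)%E = _]product_measure1E//.
rewrite /= !bernoulli_probE// !diracE !classical_sets.in_set1 /=.
rewrite !mule1 !mule0 adde0 add0e muleC (muleC (U _)); congr (_ + _ * _)%E.
by congr (_%:E); rewrite /unstable.onem; lra.
Qed.

Lemma uniform_prob_half_ball (R : realType) (t : R) : 0 <= t <= 2^-1 ->
  uniform_prob (half_interval R) [set x | `|x| <= t] = (2 * t)%:E.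
Proof.
move=> t01.
have -> : [set x : R | `|x| <= t] = `[- t, t]%classic.
  by apply/seteqP; split => x; rewrite /= in_itv /= ler_norml.
rewrite /uniform_prob.
rewrite (eq_integral (cst 1%E)); last first.
  move=> x; rewrite inE/= in_itv/= /uniform_pdf => xt.
  rewrite ifT; last by lra.
  by rewrite (_ : 2^-1 - - 2^-1 = 1) ?invr1//; lra.
rewrite integral_cst//= mul1e lebesgue_measure_itv/= lte_fin.
case: ifPn => tt; first by rewrite -EFinB; congr (_%:E); lra.
by congr (_%:E); lra.
Qed.

Lemma measurable_norm_le d (T : measurableType d) (R : realType) (f : T -> R)
    (t : R) : measurable_fun setT f -> measurable [set w | `|f w| <= t].
Proof.
move=> mf; rewrite -[X in measurable X]setTI; apply: measurable_fun_le => //.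
exact: measurableT_comp.
Qed.

Lemma measurable_norm_lt d (T : measurableType d) (R : realType) (f g : T -> R) :
  measurable_fun setT f -> measurable_fun setT g ->
  measurable [set w | `|f w| < `|g w|].
Proof.
move=> mf mg.
have -> : [set w | `|f w| < `|g w|] = ~` [set w | `|g w| <= `|f w|].
  by apply/seteqP; split => w /=; rewrite ltNge => /negP.
apply: measurableC; rewrite -[X in measurable X]setTI.
by apply: measurable_fun_le => //; exact: measurableT_comp.
Qed.

Lemma Pdelta_norm1_le (R : realType) (delta t : R) :
  0 <= delta <= 2^-1 -> 0 <= t <= 2^-1 ->
  Pdelta delta [set z | `|z.1| <= t] = (2 * t)%:E.
Proof.
move=> d01 t01; rewrite PdeltaE//; last first.
  by apply: measurable_norm_le; exact: measurable_fst.
rewrite uniform_prob_half_ball// -!EFinM -EFinD.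
by congr (_%:E); lra.
Qed.

Lemma Pdelta_norm2_le (R : realType) (delta t : R) :
  0 <= delta <= 2^-1 -> 0 <= t <= 2^-1 ->
  Pdelta delta [set z | `|z.2| <= t] =
  (1 - (2^-1 + delta) * (1 - 2 * t))%:E.
Proof.
move=> d01 t01; rewrite PdeltaE//; last first.
  by apply: measurable_norm_le; exact: measurable_snd.
rewrite uniform_prob_half_ball//.
have -> : [set x : R | `|(x, 0%R : R).2| <= t] = setT.
  by apply/seteqP; split => x //= _; rewrite normr0; case/andP: t01.
rewrite [X in (_ + _ * X)%E]probability_setT.
rewrite -!EFinM -EFinD.
by congr (_%:E); lra.
Qed.

(** When [C] contains 0 but no point of [A], the response of a point of [A] lies
    in [C] exactly when B = 0. *)
Lemma Pdelta_rect_avoiding_diagonal (R : realType) (delta : R) (A C : set R) :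
  0 <= delta <= 2^-1 -> measurable A -> measurable C ->
  C 0 -> A `<=` ~` C ->
  (Pdelta delta (A `*` C) = (2^-1 - delta)%:E * Pdelta delta (A `*` setT))%E.
Proof.
move=> d01 mA mC C0 AC.
rewrite !PdeltaE//; [|exact: measurableX..].
have -> : [set x | (A `*` C) (x, x)] = set0.
  by apply/seteqP; split => x //= [/AC].
have -> : [set x | (A `*` C) (x, 0%R : R)] = A.
  by apply/seteqP; split => x //= [].
have -> : [set x | (A `*` setT) (x, x)] = A.
  by apply/seteqP; split => x //= [].
rewrite measure0 mule0 add0e -ge0_muleDl ?lee_fin; [|lra..].
rewrite -EFinD.
have -> : 2^-1 + delta + (2^-1 - delta) = 1 by lra.
by rewrite mul1e.
Qed.

(** * Versions of the conditional median *)

(** On [A] the conditional law gives [C] mass at least 1/2, because [C] contains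
    one of the two half-lines at the median.  Integrating over {X in A}
    contradicts P(X in A, Y in C) = c P(X in A) with c < 1/2, unless X avoids
    [A] almost surely. *)
Lemma conditional_median_avoids_minority d (T : measurableType d)
    (R : realType) (P : probability T R) (X Y : T -> R) (m : R -> R)
    (A C : set R) (c : R) :
  measurable_fun setT X -> measurable A -> measurable C -> c < 2^-1 ->
  is_conditional_median P X Y m ->
  (forall x, A x -> `]-oo, m x] `<=` C \/ `[m x, +oo[ `<=` C) ->
  (P (X @^-1` A `&` Y @^-1` C) = c%:E * P (X @^-1` A))%E ->
  P (X @^-1` A) = 0%E.
Proof.
move=> mX mA mC c2 [mm [kappa klaw kmed]] AC; rewrite klaw// => lawE.
have mXA : measurable (X @^-1` A) by rewrite -[X in measurable X]setTI; exact: mX.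
have : ((2^-1)%:E * P (X @^-1` A) <= c%:E * P (X @^-1` A))%E.
  rewrite -lawE -integral_cst//; apply: ae_ge0_le_integral => //.
  - by move=> w _; rewrite lee_fin invr_ge0.
  - apply: measurable_funTS.
    by apply: (measurableT_comp (measurable_kernel kappa C mC)).
  - apply: filterS kmed => w [ml mr] Aw.
    have [] := AC _ Aw => sub.
    + by apply: (le_trans ml); apply: le_measure; rewrite ?inE.
    + by apply: (le_trans mr); apply: le_measure; rewrite ?inE.
have Pge0 : (0 <= P (X @^-1` A))%E by exact: measure_ge0.
have Pfin : P (X @^-1` A) \is a fin_num by rewrite fin_num_measure.
move: Pfin Pge0; case: (P (X @^-1` A)) => // a _.
rewrite -!EFinM !lee_fin => a0 ca; congr (_%:E).
by apply/eqP; rewrite eq_le a0 andbT; nra.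
Qed.

(** Outside {|X| <= t}, having |m(X)| <= t forces X > t >= m(X) or
    X < -t <= m(X).  In both cases a half-line at the median lies in a half-line
    that contains 0 and misses X, so that Y falls in it only when B = 0: these
    events are null. *)
Lemma conditional_median_norm_le d (T : measurableType d) (R : realType)
    (P : probability T R) (Z : T -> R * R) (m : R -> R) (delta t : R) :
  0 < delta <= 2^-1 -> 0 <= t <= 2^-1 ->
  measurable_fun setT Z ->
  (forall A, measurable A -> pushforward P Z A = Pdelta delta A) ->
  is_conditional_median P (fun w => (Z w).1) (fun w => (Z w).2) m ->
  (P [set w | (`|m (Z w).1| <= t)%R] <= (2 * t)%:E)%E.
Proof.
move=> d01 t01 mZ lawZ med.
have d01' : 0 <= delta <= 2^-1 by case/andP: d01 => /ltW -> ->.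
have mX : measurable_fun setT (fun w => (Z w).1).
  by apply: measurableT_comp => //; exact: measurable_fst.
have mm : measurable_fun setT m by case: med.
have mXA A : measurable A -> measurable ((fun w => (Z w).1) @^-1` A).
  by move=> mA; rewrite -[X in measurable X]setTI; exact: mX.
have nullA (A C : set R) : measurable A -> measurable C -> C 0 -> A `<=` ~` C ->
    (forall x, A x -> `]-oo, m x] `<=` C \/ `[m x, +oo[ `<=` C) ->
    P ((fun w => (Z w).1) @^-1` A) = 0%E.
  move=> mA mC C0 AC sub.
  apply: (conditional_median_avoids_minority (C := C) (c := 2^-1 - delta)
    _ _ _ _ med) => //.
    by lra.
  rewrite (_ : _ `&` _ = Z @^-1` (A `*` C)) //.
  rewrite [LHS](lawZ _ (measurableX mA mC)) Pdelta_rect_avoiding_diagonal//.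
  rewrite -lawZ; last exact: measurableX.
  by congr (_ * P _)%E; apply/seteqP; split => w //= [].
pose Ar : set R := `]t, +oo[ `&` [set x | m x <= t].
pose Al : set R := `]-oo, - t[ `&` [set x | - t <= m x].
have mAr : measurable Ar.
  apply: measurableI => //; rewrite -[X in measurable X]setTI.
  exact: measurable_fun_le.
have mAl : measurable Al.
  apply: measurableI => //; rewrite -[X in measurable X]setTI.
  exact: measurable_fun_le.
have PAr : P ((fun w => (Z w).1) @^-1` Ar) = 0%E.
  apply: (nullA _ `]-oo, t]%classic) => //=.
  - by rewrite in_itv/=; case/andP: t01.
  - by move=> x [/=]; rewrite !in_itv/= andbT => tx _; apply/negP; rewrite -ltNge.
  - by move=> x [_ /= mxt]; left => y /=; rewrite !in_itv/= => /le_trans; apply.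
have PAl : P ((fun w => (Z w).1) @^-1` Al) = 0%E.
  apply: (nullA _ `[- t, +oo[%classic) => //=.
  - by rewrite in_itv/=; lra.
  - by move=> x [/=]; rewrite !in_itv/= andbT => tx _; apply/negP; rewrite -ltNge.
  - by move=> x [_ /= mxt]; right => y /=; rewrite !in_itv/= !andbT; exact: le_trans.
have PX : P [set w | `|(Z w).1| <= t] = (2 * t)%:E.
  rewrite -(Pdelta_norm1_le d01' t01) -lawZ//.
  by apply: measurable_norm_le; exact: measurable_fst.
rewrite -PX -[leRHS]adde0 -PAr -[leRHS]adde0 -PAl.
have mb : measurable [set w | `|(Z w).1| <= t] by exact: measurable_norm_le.
apply: (@le_trans _ _ (P ([set w | (`|(Z w).1| <= t)%R] `|`
    (fun w => (Z w).1) @^-1` Ar `|` (fun w => (Z w).1) @^-1` Al))).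
  apply: le_measure; rewrite ?inE.
  - by apply: measurable_norm_le; exact: measurableT_comp.
  - by apply: measurableU; [apply: measurableU|] => //; exact: mXA.
  - move=> w /=; rewrite ler_norml => /andP[mtl mtr].
    have [xt|tx] := leP `|(Z w).1| t; first by left; left.
    move: tx; rewrite lter_normr => /orP[tx|tx].
      by left; right; rewrite /Ar /= in_itv/= andbT.
    by right; rewrite /Al /= in_itv/=; split=> //; lra.
apply: (le_trans (measureU2 _ _ _)).
- by apply: measurableU => //; exact: mXA.
- exact: mXA.
by apply: leeD => //; apply: measureU2 => //; exact: mXA.
Qed.

(** * Events with a random index *)

Lemma measurable_random_index d (T : measurableType d) (F : finType)
    (S : T -> F) (E : F -> set T) :
  (forall s, measurable (S @^-1` [set s])) -> (forall s, measurable (E s)) ->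
  measurable [set w | E (S w) w].
Proof.
move=> mS mE.
have -> : [set w | E (S w) w] =
    \bigcup_(s in [set: F]) (S @^-1` [set s] `&` E s).
  apply/seteqP; split => w /=; first by exists (S w).
  by move=> [s _ [/= ->]].
by apply: fin_bigcup_measurable => // s _; exact: measurableI.
Qed.

(** Total probability over the values of the index: by independence the bound is
    only averaged.  A bound for the values that the index takes is enough, since
    the other ones have an empty fiber. *)
Lemma independent_index_le d (T : measurableType d) (R : realType)
    (P : probability T R) (F : finType) (S : T -> F) (E : F -> set T) (c : R) :
  (forall s, measurable (S @^-1` [set s])) -> (forall s, measurable (E s)) ->
  (forall s, P (S @^-1` [set s] `&` E s) = P (S @^-1` [set s]) * P (E s))%E ->
  (forall w, (P (E (S w)) <= c%:E)%E) ->
  (P [set w | E (S w) w] <= c%:E)%E.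
Proof.
move=> mS mE indep Pc.
have -> : [set w | E (S w) w] =
    \bigcup_(s in [set: F]) (S @^-1` [set s] `&` E s).
  apply/seteqP; split => w /=; first by exists (S w).
  by move=> [s _ [/= ->]].
have tS : trivIset setT (fun s : F => S @^-1` [set s]).
  by move=> s s' _ _ [w [/= <- <-]].
have fF : finite_set [set: F] by exact: finite_finset.
rewrite measure_fin_bigcup//; last 2 first.
- by move=> s s' _ _ [w [[/= <- _] [/= <- _]]].
- by move=> s _; exact: measurableI.
have PS : (\sum_(s \in [set: F]) P (S @^-1` [set s]) = 1)%E.
  rewrite -(measure_fin_bigcup P _ tS)//.
  rewrite -(probability_setT P); congr (P _).
  by apply/seteqP; split => w // _; exists (S w).
rewrite -[leRHS]mul1e -PS ge0_mule_fsuml//.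
apply: lee_fsum => [//|s _ /=]; rewrite indep.
have [->|/set0P[w /= Sw]] := eqVneq (S @^-1` [set s]) set0.
  by rewrite measure0 !mul0e.
by apply: lee_wpmul2l => //; rewrite -Sw.
Qed.

Lemma g_sigma_preimage_coord d (U : measurableType d) (T : Type) n
    (Z : 'I_n -> T -> U) (i : 'I_n) (A : set U) :
  measurable A -> g_sigma_preimage Z (Z i @^-1` A).
Proof.
move=> mA; apply: sub_sigma_algebra.
by rewrite (bigD1 i)//=; left; exists A => //; rewrite setTI.
Qed.

(** The generated sigma-algebra is regarded as that of another measurable
    structure on [T], which reduces the claim to the measurability of counts. *)
Lemma g_sigma_preimage_count_lt d (U : measurableType d) d' (T : measurableType d') n
    (Z : 'I_n -> T -> U) (I : Type) (f : I -> 'I_n) (g : U -> bool) (J : seq I)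
    (k : nat) :
  measurable [set z | g z] ->
  g_sigma_preimage Z [set w | (count (fun i => g (Z (f i) w)) J < k)%N].
Proof.
move=> mg; rewrite /g_sigma_preimage; set G := (X in <<s X >>).
apply: (@measurable_count_lt _ (g_sigma_algebraType G) _ (fun i w => g (Z (f i) w))) => i.
exact: (@g_sigma_preimage_coord _ _ _ _ Z (f i) _ mg).
Qed.

(** * Coverage by the split interval *)

Lemma split_interval_zero_fitP (R : realType) (alpha : R) n
    (D : 'I_n -> R * R) (S : {set 'I_n} * {set 'I_n}) (x y : R) :
  0 < alpha < 2 ->
  split_interval (@zero_fit R) alpha D S x y <->
  (count (fun i => `|(D i).2| < `|y|)%R (enum S.2) <
    `|Num.ceil ((1 - alpha / 2) * #|S.2|.+1%:R)|)%N.
Proof.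
move=> alpha02; rewrite /split_interval /=.
set Q := conformal_quantile _ _.
have -> : ((zero_fit [seq D i | i <- enum S.1] x)%:E - Q <= y%:E <=
    (zero_fit [seq D i | i <- enum S.1] x)%:E + Q)%E = (`|y|%:E <= Q)%E.
  rewrite /zero_fit !add0e; case: Q => [r| |] /=.
  - by rewrite !lee_fin -ler_norml.
  - by rewrite leNye !leey.
  - by rewrite !leeNy_eq.
rewrite conformal_quantile_ge; last by lra.
rewrite size_map -cardE count_map.
rewrite (_ : count _ _ = count (fun i => `|(D i).2| < `|y|) (enum S.2))//.
by apply: eq_count => i; rewrite /= /zero_fit subr0.
Qed.

Lemma iid_pair d d' (T : measurableType d) (U : measurableType d')
    (R : realType) (P : probability T R) (I : finType) (Z : I -> T -> U)
    (law : set U -> \bar R) (A : set U) (i j : I) :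
  iid P Z law -> measurable A -> i != j ->
  (P (Z i @^-1` A `&` Z j @^-1` A) = law A * law A)%E.
Proof.
move=> [_ indep Zlaw] mA ij.
have -> : Z i @^-1` A `&` Z j @^-1` A =
    [set w | forall l, l \in [set i; j]%SET -> A (Z l w)].
  apply/seteqP; split => w /=.
    by move=> [Ai Aj] l; rewrite !inE => /orP[] /eqP ->.
  by move=> Al; split; apply: Al; rewrite !inE eqxx ?orbT.
rewrite (indep [set i; j]%SET (fun=> A))//.
rewrite (bigD1 i) ?(inE, eqxx)//= (bigD1 j) ?(inE, eqxx, orbT, eq_sym j)//=.
rewrite big1 => [|l /andP[/andP[+ li] lj]]; last first.
  by rewrite !inE (negbTE li) (negbTE lj).
by rewrite mule1; congr (_ * _)%E; exact: Zlaw.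
Qed.

Lemma iid_count_lt_chebyshev d d' (T : measurableType d) (U : measurableType d')
    (R : realType) (P : probability T R) (I J : finType) (Z : I -> T -> U)
    (f : J -> I) (law : set U -> \bar R) (g : U -> bool) (s : seq J) (q a : R)
    (k : nat) :
  iid P Z law -> injective f -> measurable [set z | g z] ->
  law [set z | g z] = q%:E -> uniq s -> 0 < a ->
  k%:R <= (size s)%:R * q - a ->
  (P [set w | (count (fun i => g (Z (f i) w)) s < k)%N]
     <= ((size s)%:R / a ^+ 2)%:E)%E.
Proof.
move=> Ziid injf mg lawg us a0 kqa; have [mZ _ Zlaw] := Ziid.
apply: (@count_lt_chebyshev _ _ _ P _ (fun i w => g (Z (f i) w)) _ q) => //.
- by move=> i; rewrite -[X in measurable X]setTI; exact: (mZ (f i) measurableT _ mg).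
- by move=> i _; rewrite -lawg -(Zlaw (f i)).
- move=> i j _ _ ij; rewrite EFinM -lawg; apply: (iid_pair Ziid) => //.
  by rewrite (inj_eq injf).
Qed.

(** Here 1 - (1/2 + h/8)(alpha - h/2) is the probability that a score is at most
    t when delta = h/8 and 2t = 1 - alpha + h/2.  It exceeds the level
    1 - alpha/2 by at least h/8, since the gain h/4 coming from t outweighs the
    loss at most h/8 coming from delta.  Half of this margin, times [m], absorbs
    the terms of order one in the rank: the lower bound on [m] gives
    [512 <= m * h], and the constant 512 is the one that makes the Chebyshev
    bound m / (m h / 16)^2 at most h/2. *)
Lemma calibration_rank_below_mean (R : realType) (alpha h : R) (m : nat) :
  0 < h -> h <= alpha -> alpha < 1 -> 512 <= m%:R * h ^+ 3 ->
  (`|Num.ceil ((1 - alpha / 2) * m.+1%:R)|%N)%:R <=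
  m%:R * (1 - (2^-1 + h / 8) * (alpha - h / 2)) - m%:R * h / 16.
Proof.
move=> h0 ha a1 mh.
set x := (1 - alpha / 2) * _.
have ceil0 : 0 <= Num.ceil x.
  by rewrite ceil_ge0 (lt_le_trans (ltrN10 _))// mulr_ge0//; lra.
have kx : (`|Num.ceil x|%N)%:R < x + 1.
  rewrite -[(_)%:R]/(`|Num.ceil x|%:Z%:~R) gez0_abs// -ltrBlDr -[1]/(1%:~R).
  by rewrite -rmorphB/=; exact: ceilB1_lt.
have mh1 : 512 <= m%:R * h.
  by rewrite (le_trans mh)// ler_wpM2l// exprS ler_piMr ?exprn_ile1//; lra.
rewrite /x -(natr1 m) in kx *.
have step : m%:R * h / 16 <= m%:R *
    (alpha / 2 - (2^-1 + h / 8) * (alpha - h / 2) - h / 16).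
  by rewrite -mulrA ler_wpM2l//; nra.
lra.
Qed.

Unset Implicit Arguments.
Set Strict Implicit.

Theorem theorem3 (R : realType) (alpha : R) (halpha : 0 < alpha < 1)
    (eps : R) (heps : 0 < eps) :
  exists (N : nat) (delta : R), 0 < delta <= 2^-1 /\
    forall n : nat, (N < n)%N -> ~~ odd n ->
    forall (d : measure_display) (T : measurableType d) (P : probability T R)
      (Z : 'I_n.+1 -> T -> R * R) (S : T -> {set 'I_n} * {set 'I_n})
      (m : R -> R),
    let X i w := (Z i w).1 in
    let Y i w := (Z i w).2 in
    iid P Z (Pdelta delta) ->
    random_split P Z n./2 n./2 S ->
    is_conditional_median P (X ord_max) (Y ord_max) m ->
    (P [set w | split_interval (@zero_fit R) alpha
                  (fun i : 'I_n => Z (lift ord_max i) w) (S w) (X ord_max w)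
                  (m (X ord_max w))]
      <= (1 - alpha + eps)%:E)%E.
Proof.
have [h [h0 ha he]] : exists h, [/\ 0 < h, h <= alpha & h <= eps].
  exists (Num.min alpha eps); split; rewrite ?ge_min ?lexx ?orbT//.
  by rewrite lt_min heps andbT; case/andP: halpha.
have a1 : alpha < 1 by case/andP: halpha.
exists (Num.bound (512 / h ^+ 3)).*2, (h / 8); split; first by lra.
move=> n nN _ d T P Z S m X Y Ziid [mS Ssize Sindep] med.
have [mZ _ Zlaw] := Ziid.
set mm := n./2 in Ssize *.
have mh : 512 <= mm%:R * h ^+ 3.
  rewrite -ler_pdivrMr ?exprn_gt0//.
  have : 0 <= 512 / h ^+ 3 by apply: divr_ge0; rewrite ?ler0n ?exprn_ge0 ?ltW.
  move: nN; move: (512 / h ^+ 3) => c cn /archi_boundP /ltW/le_trans; apply.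
  by rewrite ler_nat geq_half_double ltnW.
pose t : R := (1 - alpha + h / 2) / 2.
have t01 : 0 <= t <= 2^-1 by rewrite /t; lra.
have d01 : 0 < h / 8 <= 2^-1 by lra.
pose k := `|Num.ceil ((1 - alpha / 2) * mm.+1%:R)|%N.
pose E (s : {set 'I_n} * {set 'I_n}) : set T :=
  [set w | (count (fun i => `|Y (lift ord_max i) w| <= t)%R (enum s.2) < k)%N].
have mX i : measurable_fun setT (X i).
  by apply: measurableT_comp => //; exact: measurable_fst.
have mY i : measurable_fun setT (Y i).
  by apply: measurableT_comp => //; exact: measurable_snd.
have mmX : measurable_fun setT (fun w => m (X ord_max w)).
  by apply: measurableT_comp => //; case: med.
have mE s : measurable (E s).
  apply: (@measurable_count_lt _ _ _ (fun i w => `|Y (lift ord_max i) w| <= t)) => i.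
  exact: measurable_norm_le.
have mg : measurable [set z : R * R | `|z.2| <= t].
  by apply: measurable_norm_le; exact: measurable_snd.
(* For a calibration set [s.2] of the prescribed size, [E s] is the event that
   the quantile of its scores exceeds [t]. *)
have PE : (P [set w | E (S w) w] <= (h / 2)%:E)%E.
  apply: independent_index_le => // [s|w].
    apply: Sindep.
    exact: (@g_sigma_preimage_count_lt _ _ _ _ _ Z _ (lift ord_max)
      (fun z => `|z.2| <= t)).
  (* From here on the split is fixed to one of its values. *)
  have [_ _ _ cardS] := Ssize w.
  have mm0 : 0 < mm%:R :> R.
    by rewrite ltr0n lt0n; apply: contraTneq mh => ->; rewrite mul0r -ltNge ltr0n.
  have a0 : 0 < mm%:R * h / 16 by rewrite divr_gt0// mulr_gt0.
  have sz : size (enum (S w).2) = mm by rewrite -cardE.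
  apply: (@le_trans _ _ (mm%:R / (mm%:R * h / 16) ^+ 2)%:E).
    have d01' : 0 <= h / 8 <= 2^-1 by lra.
    have lawg := Pdelta_norm2_le d01' t01.
    have tail := @iid_count_lt_chebyshev _ _ _ _ _ P _ _ Z (lift ord_max) _
      (fun z => `|z.2| <= t) (enum (S w).2) _ (mm%:R * h / 16) k Ziid
      (@lift_inj _ _) mg lawg (enum_uniq _) a0.
    rewrite sz in tail *; apply: tail.
    rewrite (_ : 1 - 2 * t = alpha - h / 2); last by rewrite /t; lra.
    exact: calibration_rank_below_mean.
  rewrite lee_fin ler_pdivrMr ?exprn_gt0//.
  have -> : h / 2 * (mm%:R * h / 16) ^+ 2 = mm%:R * (mm%:R * h ^+ 3 / 512) by field.
  by rewrite ler_peMr//; lra.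
have Pm : (P [set w | (`|m (X ord_max w)| <= t)%R] <= (1 - alpha + h / 2)%:E)%E.
  rewrite (_ : 1 - alpha + h / 2 = 2 * t); last by rewrite /t; lra.
  exact: (conditional_median_norm_le d01 t01 (mZ ord_max) (Zlaw ord_max) med).
have mEm : measurable [set w | (`|m (X ord_max w)| <= t)%R].
  exact: measurable_norm_le.
pose G (s : {set 'I_n} * {set 'I_n}) : set T := [set w |
  (count (fun i => `|Y (lift ord_max i) w| < `|m (X ord_max w)|)%R (enum s.2) <
    `|Num.ceil ((1 - alpha / 2) * #|s.2|.+1%:R)|)%N].
have GE : [set w | split_interval (@zero_fit R) alpha
    (fun i : 'I_n => Z (lift ord_max i) w) (S w) (X ord_max w)
    (m (X ord_max w))] = [set w | G (S w) w].
  by apply/seteqP; split => w /split_interval_zero_fitP; apply; lra.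
rewrite GE.
apply: (@le_trans _ _ (P ([set w | (`|m (X ord_max w)| <= t)%R] `|`
    [set w | E (S w) w]))).
  apply: le_measure; rewrite ?inE.
  - apply: measurable_random_index => // s.
    apply: (@measurable_count_lt _ _ _ (fun i w =>
      `|Y (lift ord_max i) w| < `|m (X ord_max w)|)) => i.
    exact: measurable_norm_lt.
  - by apply: measurableU => //; exact: measurable_random_index.
  - move=> w /= Gw; have [mt|tm] := leP `|m (X ord_max w)| t; first by left.
    have [_ _ _ cardS] := Ssize w.
    right; rewrite /E /k -cardS; apply: leq_ltn_trans Gw.
    by apply: sub_count => i /le_lt_trans; apply.
apply: (le_trans (measureU2 _ _ _)) => //; first exact: measurable_random_index.
apply: (le_trans (leeD Pm PE)).
by rewrite -EFinD lee_fin; lra.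
Qed.
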